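(* Let $\{\mathcal{G}_N\}$ be a family of connected, undirected, weighted graphs, where $\mathcal{G}_N=\{\mathcal{V}_N,\mathcal{E}_N\}$ has $N=|\mathcal{V}_N|\ge 2$ nodes. Suppose that there are constants $q$ and $0<w_{\min}\le w_{\max}<\infty$, independent of $N$, such that in every graph $\mathcal{G}_N$ of the family each node $i\in\mathcal{V}_N$ has at most $q$ neighbors, $|\mathcal{N}_i|\le q$, and each edge weight satisfies $w_{\min}\le w_{ij}\le w_{\max}$ for all $(i,j)\in\mathcal{E}_N$. Then the smallest eigenvalue $\bar{\lambda}_1(\mathcal{G}_N)$ of the grounded Laplacian $\bar{L}(\mathcal{G}_N)$ satisfies $$\bar{\lambda}_1(\mathcal{G}_N)\le \frac{q}{N-1}\,w_{\max}$$ for every graph $\mathcal{G}_N$ in the family.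
   Context: All graphs are finite, simple (no self-loops), undirected and connected, and each edge $(i,j)$ carries a weight $w_{ij}=w_{ji}>0$ (with $w_{ij}=0$ if $i\ne j$ and $(i,j)$ is not an edge). $\mathcal{N}_i$ denotes the set of neighbors of node $i$. The weighted graph Laplacian $L$ of a graph on $N$ nodes is the symmetric $N\times N$ matrix with $L_{ii}=\sum_{k\ne i}w_{ik}$ and $L_{ij}=-w_{ij}$ for $i\neq j$. One node of the graph is designated as the grounded node (the leader); the nodes are numbered so that it is node $1$. The grounded Laplacian $\bar{L}$ is the $(N-1)\times(N-1)$ matrix obtained from $L$ by deleting the first row and first column. Its eigenvalues are numbered in increasing order, with $\bar{\lambda}_1$ the smallest. A graph family $\{\mathcal{G}_N\}$ is a sequence of graphs in which the network size $N$ is increasing. *)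

(* Defs.v *)
From mathcomp Require Import all_boot all_order all_algebra.
From mathcomp Require Import reals.

Set Implicit Arguments.
Unset Strict Implicit.
Unset Printing Implicit Defensive.

Import Order.TTheory GRing.Theory Num.Theory.
Local Open Scope ring_scope.

Record wgraph (R : realType) (N : nat) := WGraph {
  adj : rel 'I_N;
  weight : 'I_N -> 'I_N -> R;
  adj_sym : symmetric adj;
  adj_irr : irreflexive adj;
  weight_sym : forall i j, weight i j = weight j i;
  weight_gt0 : forall i j, adj i j -> 0 < weight i j;
  weight_eq0 : forall i j, i != j -> ~~ adj i j -> weight i j = 0
}.

Definition neighbors (R : realType) (N : nat) (G : wgraph R N) (i : 'I_N) :
    {set 'I_N} :=
  [set j | adj G i j].

Definition connected (R : realType) (N : nat) (G : wgraph R N) : Prop :=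
  forall i j : 'I_N, connect (adj G) i j.

Definition laplacian (R : realType) (N : nat) (G : wgraph R N) : 'M[R]_N :=
  \matrix_(i, j)
    if i == j then \sum_(k | k != i) weight G i k else - weight G i j.

(* Nodes are counted from 0 here: node 1, the grounded one, is the ordinal 0. *)
Definition leader (N : nat) (hN : (2 <= N)%N) : 'I_N := Ordinal (ltnW hN).

Definition grounded_laplacian (R : realType) (N : nat) (hN : (2 <= N)%N)
    (G : wgraph R N) : 'M[R]_(N.-1) :=
  row' (leader hN) (col' (leader hN) (laplacian G)).

(* [eigenvalue] refers to row eigenvectors; this makes no difference for the
   set of eigenvalues of a square matrix. *)
Definition smallest_eigenvalue (R : realType) (n : nat) (A : 'M[R]_n)
    (lambda : R) : Prop :=
  eigenvalue A lambda /\ forall mu : R, eigenvalue A mu -> lambda <= mu.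

(* Main.v *)
(** By the spectral theorem the smallest eigenvalue of a symmetric real matrix
    is at most its Rayleigh quotient at any nonzero vector. At the all-ones
    vector the numerator is the sum of the entries of the grounded Laplacian;
    as the rows of the Laplacian sum to zero, this is the total weight of the
    edges at the leader, hence at most [q * wmax], while the denominator is
    [N - 1]. *)

Require Import Defs.
From mathcomp Require Import all_boot all_order all_algebra.
From mathcomp Require Import reals complex.

Import Order.TTheory GRing.Theory Num.Theory.
Local Open Scope ring_scope.
Local Open Scope sesquilinear_scope.
Local Open Scope complex_scope.

Lemma mul_row_diag_similar (F : fieldType) n (P A : 'M[F]_n) (d : 'rV[F]_n) i :
  P \in unitmx -> A = invmx P *m diag_mx d *m P ->
  row i P *m A = d 0 i *: row i P.
Proof.
move=> uP ->; rewrite -row_mul !mulmxA mulmxV// mul1mx.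
by apply/rowP => j; rewrite mul_diag_mx !mxE.
Qed.

(** An eigenvector [v] of [A] becomes the eigenvector [v *m invmx P] of the diagonal matrix, and any
    nonzero coordinate of it identifies [a]. Conversely, the rows of [P] are eigenvectors of [A]. *)
Lemma eigenvalue_diag_similar (F : fieldType) n (P A : 'M[F]_n)
    (d : 'rV[F]_n) a :
  P \in unitmx -> A = invmx P *m diag_mx d *m P ->
  reflect (exists i, a = d 0 i) (eigenvalue A a).
Proof.
move=> uP defA; apply: (iffP eigenvalueP) => [[v vA nzv] | [i ->]].
  pose u := v *m invmx P.
  have nzu : u != 0.
    by apply: contraNneq nzv => u0; rewrite -[v](mulmxKV uP) -/u u0 mul0mx.
  have ud : u *m diag_mx d = a *: u.
    by rewrite scalemxAl -vA defA !mulmxA mulmxK.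
  have /rV0Pn[i nzui] := nzu; exists i.
  have /rowP/(_ i) := ud.
  by rewrite mul_mx_diag mxE [RHS]mxE mulrC => /(mulIf nzui).
exists (row i P); first exact: mul_row_diag_similar.
(* A zero row of [P] would force a zero row in [P *m invmx P], the identity. *)
apply/eqP => Pi0; have := row_mul i P (invmx P).
rewrite Pi0 mul0mx mulmxV// => /rowP/(_ i); rewrite !mxE eqxx => /eqP.
by rewrite oner_eq0.
Qed.

(** In the unitary coordinates [y = x *m invmx P] the squared norm is unchanged and the form becomes
    the sum of [d 0 i] times the squared modulus of [y 0 i], so the bound holds term by term. *)
Lemma hermitian_form_ge (C : numClosedFieldType) n (A : 'M[C]_n) (c : C)
    (x : 'rV[C]_n) :
  A \is hermsymmx -> (forall i, c <= spectral_diag A 0 i) ->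
  c * (x *m x ^t*) 0 0 <= (x *m A *m x ^t*) 0 0.
Proof.
move=> hA c_le; set P := spectralmx A; set d := spectral_diag A.
have uP : P \is unitarymx := spectral_unitarymx A.
have iP : invmx P = P ^t* by rewrite invmx_unitary.
have defA : A = invmx P *m diag_mx d *m P.
  exact/orthomx_spectralP/hermitian_normalmx.
pose y := x *m invmx P.
have yC : y ^t* = P *m x ^t*.
  by rewrite /y iP trmx_mul map_mxM trmxCK.
have -> : x *m x ^t* = y *m y ^t*.
  by rewrite yC /y mulmxA mulmxKV // spectral_unit.
have -> : x *m A *m x ^t* = y *m diag_mx d *m y ^t*.
  by rewrite yC defA /y !mulmxA.
move: y {yC} => y; rewrite mul_mx_diag !mxE mulr_sumr; apply: ler_sum => i _.
rewrite !mxE [y 0 i * d 0 i]mulrC -mulrA ler_wpM2r// mul_conjC_ge0//.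
Qed.

(* [A] is diagonalized as a Hermitian matrix over the complex numbers; its
   spectrum there is real, hence consists of eigenvalues of [A] over [R]. *)
Lemma symmetric_smallest_eigenvalue (R : realType) n (A : 'M[R]_n) :
  (0 < n)%N -> A^T = A ->
  exists2 l : R, smallest_eigenvalue A l &
    forall x : 'rV[R]_n, l * (x *m x^T) 0 0 <= (x *m A *m x^T) 0 0.
Proof.
case: n A => // n A _ symA; pose B := map_mx (real_complex R) A.
have conjE m p (M : 'M[R]_(m, p)) :
    (map_mx (real_complex R) M) ^t* = map_mx (real_complex R) M^T.
  by apply/matrixP => i j; rewrite !mxE; exact: conjc_real.
have hB : B \is hermsymmx.
  by apply/is_hermitianmxP; rewrite expr0 scale1r conjE symA.
have defB := orthomx_spectralP (hermitian_normalmx hB).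
have eigB := eigenvalue_diag_similar _ _ _ _ _ _ (spectral_unit B) defB.
pose r i : R := complex.Re (spectral_diag B 0 i).
have dE i : spectral_diag B 0 i = (r i)%:C.
  have /mxOverP/(_ 0 i) := hermitian_spectral_diag_real hB.
  by move/RRe_real => <-.
have eigA a : reflect (exists i, a = r i) (eigenvalue A a).
  (* A real number is an eigenvalue of [A] exactly when its image is one of [B]. *)
  rewrite -(eigenvalue_map (real_complex R)).
  apply: (iffP (eigB a%:C)) => -[j]; first by rewrite dE => /complexI; exists j.
  by move=> ->; exists j; rewrite dE.
have [i0 _ r_min] := @arg_minP _ _ _ ord0 predT r isT.
exists (r i0).
  split; first by apply/eigA; exists i0.
  by move=> mu /eigA[j ->]; exact: r_min.
move=> x; pose z := map_mx (real_complex R) x.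
have d_ge i : (r i0)%:C <= spectral_diag B 0 i.
  by rewrite dE lecR r_min.
have := hermitian_form_ge _ _ _ _ z hB d_ge.
by rewrite conjE -!map_mxM !mxE -rmorphM lecR.
Qed.

Lemma sum_lift_ord (V : zmodType) n (l : 'I_n) (F : 'I_n -> V) :
  \sum_(i < n.-1) F (lift l i) = \sum_(i | i != l) F i.
Proof.
rewrite [RHS]big_mkcond (bigD1_ord l)//= eqxx add0r.
by apply: eq_bigr => i _; rewrite eq_sym neq_lift.
Qed.

Lemma laplacian_row_sum (R : realType) N (G : wgraph R N) i :
  \sum_j laplacian G i j = 0.
Proof.
rewrite (bigD1 i)//= mxE eqxx -big_split big1//= => j ji.
by rewrite mxE eq_sym (negPf ji) subrr.
Qed.

Lemma laplacian_sym (R : realType) N (G : wgraph R N) :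
  (laplacian G)^T = laplacian G.
Proof.
apply/matrixP => i j; rewrite !mxE eq_sym weight_sym.
by case: eqP => // ->.
Qed.

Lemma grounded_laplacian_sym (R : realType) N (hN : (2 <= N)%N)
    (G : wgraph R N) :
  (grounded_laplacian hN G)^T = grounded_laplacian hN G.
Proof.
rewrite /grounded_laplacian tr_row' tr_col' laplacian_sym.
by apply/matrixP => i j; rewrite !mxE.
Qed.

(** Each row of the grounded Laplacian is a zero-sum row with its leader entry deleted, so it sums
    to the weight between that node and the leader. *)
Lemma grounded_laplacian_sum (R : realType) N (hN : (2 <= N)%N)
    (G : wgraph R N) :
  \sum_i \sum_j grounded_laplacian hN G i j =
  \sum_(i | i != leader hN) weight G (leader hN) i.
Proof.
rewrite -sum_lift_ord; apply: eq_bigr => i _.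
have /eqP := laplacian_row_sum R N G (lift (leader hN) i).
rewrite (bigD1_ord (leader hN))//= addrC addr_eq0 => /eqP E.
under eq_bigr do rewrite /grounded_laplacian 2!mxE.
by rewrite E mxE eq_sym (negPf (neq_lift _ _)) opprK weight_sym.
Qed.

Lemma weighted_degree_le (R : realType) N (G : wgraph R N) (i : 'I_N) (w : R) :
  (forall j, adj G i j -> weight G i j <= w) ->
  \sum_(j | j != i) weight G i j <= #|neighbors G i|%:R * w.
Proof.
move=> w_ge; rewrite mulr_natl -sumr_const [leRHS]big_mkcond [leLHS]big_mkcond.
(* Both sides are now sums over all nodes, padded with zeros: [w] on neighbors at the right, the
   weights off [i] at the left. *)
apply: ler_sum => j _; rewrite inE; have [->|ji] := eqVneq j i.
  by rewrite adj_irr.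
have [/w_ge//|nij] := boolP (adj G i j).
by rewrite weight_eq0// eq_sym.
Qed.

Theorem lemma4p1 (R : realType)
    (N : nat -> nat) (N_ge2 : forall k : nat, (2 <= N k)%N)
    (N_increasing : forall k l : nat, (k < l)%N -> (N k < N l)%N)
    (G : forall k : nat, wgraph R (N k))
    (G_connected : forall k : nat, connected (G k))
    (q : nat) (wmin wmax : R)
    (wmin_gt0 : 0 < wmin) (wmin_le_wmax : wmin <= wmax)
    (degree_le : forall (k : nat) (i : 'I_(N k)), (#|neighbors (G k) i| <= q)%N)
    (weight_bounds : forall (k : nat) (i j : 'I_(N k)),
       adj (G k) i j -> wmin <= weight (G k) i j <= wmax) :
  forall k : nat, exists lambda1 : R,
    smallest_eigenvalue (grounded_laplacian (N_ge2 k) (G k)) lambda1 /\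
    lambda1 <= q%:R / ((N k)%:R - 1) * wmax.
Proof.
move=> k; set hN := N_ge2 k; pose A := grounded_laplacian hN (G k).
have n_gt0 : (0 < (N k).-1)%N by rewrite -ltnS prednK// ltnW.
have [l l_min l_le] :=
  symmetric_smallest_eigenvalue _ _ A n_gt0 (grounded_laplacian_sym _ _ hN _).
exists l; split=> //.
pose u : 'rV[R]_(N k).-1 := const_mx 1.
have uu : (u *m u^T) 0 0 = (N k)%:R - 1.
  rewrite mxE (eq_bigr (fun=> 1)) => [|i _]; last by rewrite !mxE mulr1.
  by rewrite sumr_const card_ord -subn1 natrB// ltnW.
have uAu : (u *m A *m u^T) 0 0 = \sum_i \sum_j A i j.
  rewrite mxE exchange_big; apply: eq_bigr => j _.
  rewrite !mxE mulr1; apply: eq_bigr => i _.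
  by rewrite mxE mul1r.
have N1_gt0 : 0 < (N k)%:R - 1 :> R by rewrite subr_gt0 ltr1n.
(* Clearing the denominator leaves [l] times the squared norm of [u], the left side of the Rayleigh
   bound. *)
rewrite mulrAC ler_pdivlMr// -uu.
apply: le_trans (l_le u) _; rewrite uAu grounded_laplacian_sum.
apply: le_trans (weighted_degree_le _ _ _ _ wmax _) _.
  by move=> j /weight_bounds/andP[].
(* Replacing the degree of the leader by [q] uses [0 <= wmax], which follows from
   [0 < wmin <= wmax]. *)
by rewrite ler_wpM2r ?ler_nat// (le_trans (ltW wmin_gt0)).
Qed.
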